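(* For every integer $\Delta\ge 2$ and every integer $n\ge\Delta+1$, there exist an $n$-vertex bipartite graph $H$ with maximum degree at most $\Delta$ and an $n$-vertex graph $G$ with minimum degree $$\delta(G)\ge\Big(1-164\,\frac{\log\Delta}{\Delta}\Big)n$$ such that $G$ does not contain $H$ as a (not necessarily induced) subgraph.
   Context: Graphs are finite and simple. $\log$ denotes the natural logarithm. A graph $G$ contains $H$ if there is an injective map $V(H)\to V(G)$ sending every edge of $H$ to an edge of $G$. *)

(* Defs.v *)
From HB Require Import structures.
From mathcomp Require Import all_boot all_order all_algebra.
From mathcomp Require Import all_classical all_reals all_analysis.

Set Implicit Arguments.
Unset Strict Implicit.
Unset Printing Implicit Defensive.

Record sgraph := SGraph {
  vertex :> finType;
  adj : rel vertex;
  adj_sym : symmetric adj;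
  adj_irr : irreflexive adj
}.

Definition degree (G : sgraph) (v : G) : nat := #|[set w : G | adj v w]|.

Definition max_degree (G : sgraph) : nat := \max_(v : G) degree v.

(* Every degree is below #|G|, so the default value #|G| only matters for the
   graph without vertices. *)
Definition min_degree (G : sgraph) : nat := \big[minn/#|G|]_(v : G) degree v.

Definition bipartite (G : sgraph) : Prop :=
  exists A : {set G}, forall x y : G, adj x y -> (x \in A) != (y \in A).

Definition contains (G H : sgraph) : Prop :=
  exists f : H -> G, injective f /\ forall x y : H, adj x y -> adj (f x) (f y).

(* Main.v *)
Require Import Defs.
From HB Require Import structures.
From mathcomp Require Import all_boot all_order all_algebra.
From mathcomp Require Import fingroup perm.
From mathcomp Require Import all_classical all_reals all_analysis.
From mathcomp Require Import zify ring lra.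
Import Order.TTheory GRing.Theory Num.Theory.

(** Write D for the degree bound and N for the larger half of n.  The two
    graphs are chosen so that embedding one in the other would create a large
    bipartite hole, that is, two large sets without an edge between them.

    The graph G lives on 0, ..., n-1 and joins two integers when their distance
    is at least 4t, where t is about 20 n log D / D.  A vertex misses fewer than
    8t others, which gives the minimum degree, and every interval of 4t
    consecutive integers is independent.

    The graph H is bipartite with sides of sizes n./2 and uphalf n, and any t
    vertices on one side see any t vertices on the other.  It comes from a
    permutation s of the set of half-edges 'I_N * 'I_D: a is joined to b when s
    sends some half-edge of a to a half-edge of b.  All degrees are then at most
    D, whatever s is.  For a uniformly random s, fixed t-sets X and Y see no
    edge with probability at most (1 - t/N)^(tD) <= exp(- t^2 D / N), while
    there are only C(N, t)^2 <= (e N/t)^(2t) pairs of t-sets; since t/N is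
    several times log D / D, some s works for all pairs at once
    ([first_moment_lt], [exists_perm_hits]).

    Suppose that H embeds in G.  As both have n vertices, 0, ..., n-1 is
    partitioned into the images of the two sides, each with about half the
    vertices.  When an interval of length 4t slides by one step, the number of
    images of either side that it contains changes by at most one, so the
    interval cannot pass from having few images of one side to having few images
    of the other without meeting many of both; and it cannot have few images
    of the same side throughout, since that side would be too small.
    Hence some interval contains t images of each side ([balanced_window]).  It
    is independent in G, so it pulls back to a hole of H, a contradiction.

    If 164 log D / D >= 1, the degree condition is void and G can be edgeless. *)

Set Implicit Arguments.
Unset Strict Implicit.
Unset Printing Implicit Defensive.

(** * Random permutations *)

(** A permutation is determined by its restriction to P, an injection into Q,
    together with how it maps the complement of P. *)
Lemma card_perm_imset_sub (T : finType) (P Q : {set T}) :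
  #|[set s : {perm T} | [set s x | x in P] \subset Q]|
    <= #|Q| ^_ #|P| * (#|T| - #|P|)`!.
Proof.
pose restr (s : {perm T}) : {ffun {x | x \in P} -> T} := [ffun u => s (val u)].
pose inj := [set f : {ffun {x | x \in P} -> T} in ffun_on (mem Q) | injectiveb f].
rewrite -sum1_card (partition_big restr (mem inj)) /=; last first.
  move=> s /[!inE] /fintype.subsetP sPQ; apply/andP; split.
    by apply/ffun_onP => u; rewrite ffunE sPQ // imset_f // (valP u).
  by apply/injectiveP => u v /[!ffunE] /perm_inj /val_inj.
have <- : #|inj| = #|Q| ^_ #|P| by rewrite card_inj_ffuns_on card_sig.
rewrite -sum_nat_const; apply: leq_sum => g _; rewrite sum1dep_card.
set fib := [set s | _]; have [-> | [s0]] := set_0Vmem fib; first by rewrite cards0.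
rewrite inE => /andP[_ /eqP g_s0].
(* Two permutations with the same restriction differ by one fixing P. *)
have -> : #|T| - #|P| = #|~: P| by rewrite -(cardsC P) addKn.
rewrite -card_perm -(card_imset _ (mulIg s0^-1%g)); apply: subset_leq_card.
apply/fintype.subsetP => _ /imsetP[s /[!inE] /andP[_ /eqP g_s] ->].
apply/fintype.subsetP => x; rewrite !inE; apply: contra => xP.
have /ffunP/(_ (Sub x xP)) := etrans g_s (esym g_s0).
by rewrite !ffunE /= permM => ->; rewrite permK.
Qed.

Lemma card_bigcup_leq (I T : finType) (F : I -> {set T}) :
  #|\bigcup_i F i| <= \sum_i #|F i|.
Proof.
elim/big_rec2: _ => [|i m A _ leAm]; first by rewrite cards0.
by rewrite (leq_trans (leq_card_setU _ _)) ?leq_add2l.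
Qed.

Lemma card_perm_type (T : finType) : #|{: {perm T}}| = (#|T|)`!.
Proof.
rewrite -[in RHS]cardsT -card_perm; apply: eq_card => s.
by rewrite !inE; apply/esym/fintype.subsetP.
Qed.

(** First moment method: by [card_perm_imset_sub], a uniform permutation maps
    P i into Q i with probability at most q ^_ p / #|T| ^_ p, and the assumption
    says that these probabilities add up to less than 1. *)
Lemma first_moment_perm (I T : finType) (P Q : I -> {set T}) (p q : nat) :
    (forall i, #|P i| = p) -> (forall i, #|Q i| = q) ->
    #|I| * q ^_ p < #|T| ^_ p ->
  exists s : {perm T}, forall i, ~~ ([set s x | x in P i] \subset Q i).
Proof.
move=> cardP cardQ few.
have [/existsP[s /forallP sP]|none] :=
  boolP [exists s : {perm T}, [forall i, ~~ ([set s x | x in P i] \subset Q i)]].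
  by exists s.
(* Otherwise the union of the bad events is everything. *)
have le_pT : p <= #|T|.
  by rewrite leqNgt; apply/negP => /ffact_small pT0; rewrite pT0 ltn0 in few.
have cover : [set: {perm T}] \subset
    \bigcup_i [set s : {perm T} | [set s x | x in P i] \subset Q i].
  apply/fintype.subsetP => s _; move: none; rewrite negb_exists => /forallP/(_ s).
  by rewrite negb_forall => /existsP[i /negPn si]; apply/bigcupP; exists i; rewrite ?inE.
have := leq_trans (subset_leq_card cover) (card_bigcup_leq _).
rewrite cardsT card_perm_type leqNgt -(ffact_fact le_pT) => /negP[].
rewrite (leq_ltn_trans (n := #|I| * (q ^_ p * (#|T| - p)`!))) //.
  rewrite -sum_nat_const; apply: leq_sum => i _.
  by rewrite -(cardQ i) -(cardP i) card_perm_imset_sub.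
by rewrite mulnA ltn_pmul2r ?fact_gt0.
Qed.

(** Drawing p items without replacement from m of which q are good gives only
    good ones at most as often as drawing with replacement. *)
Lemma ffact_ratio (q m p : nat) : q <= m -> q ^_ p * m ^ p <= q ^ p * m ^_ p.
Proof.
move=> le_qm; elim: p => [|p IHp]; first by rewrite !expn0 !ffactn0.
rewrite !ffactnSr !expnSr mulnACA [leqRHS]mulnACA leq_mul //.
by rewrite mulnBl mulnBr leq_sub2l // [q * p]mulnC leq_mul.
Qed.

(** * Sliding windows *)

Lemma count_iota_succ (c : pred nat) i l :
  count c (iota i l) + c (i + l) = c i + count c (iota i.+1 l).
Proof. by rewrite -[RHS]/(count c (iota i l.+1)) -addn1 iotaD count_cat /= addn0. Qed.

Lemma count_iota_blocks (c : pred nat) (l t k : nat) :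
    (forall i, i + l <= k * l -> count c (iota i l) <= t) ->
  count c (iota 0 (k * l)) <= k * t.
Proof.
elim: k => [|k IHk] sparse; first by rewrite !mul0n.
rewrite !mulSnr iotaD count_cat leq_add //; last by apply: sparse; rewrite mulSnr.
by apply: IHk => i ik; apply: sparse; rewrite mulSn; apply: leq_trans ik (leq_addl _ _).
Qed.

(** A majority cannot change while sliding: if c fails fewer than t times in a
    window, it holds more than 3t times there, hence at least t times in the
    next window, where it must then fail fewer than t times again.  So the
    failures are sparse in every window; cutting [0, n) into windows leaves a
    remainder shorter than 4t, which may consist of failures only. *)
Lemma count_predC_dominated (c : pred nat) (n t : nat) :
    0 < t -> 8 * t <= n -> t <= count c (iota 0 (4 * t)) ->
    (forall i, i + 4 * t <= n -> t <= count c (iota i (4 * t)) ->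
       count (predC c) (iota i (4 * t)) < t) ->
  count (predC c) (iota 0 n) < n./2.
Proof.
move=> t0 tn start unbal.
have compl i : count c (iota i (4 * t)) + count (predC c) (iota i (4 * t)) = 4 * t.
  by rewrite count_predC size_iota.
have dom i : i + 4 * t <= n -> t <= count c (iota i (4 * t)).
  elim: i => // i IHi lei; have lei' : i + 4 * t <= n by lia.
  have := unbal _ lei' (IHi lei'); have := compl i.
  by have := count_iota_succ c i (4 * t); lia.
pose k := n %/ (4 * t); pose r := n %% (4 * t).
have nE : n = k * (4 * t) + r by exact: divn_eq.
have r_lt : r < 4 * t by rewrite ltn_mod; lia.
have k_ge : 2 <= k by rewrite leq_divRL; lia.
have blocks : count (predC c) (iota 0 (k * (4 * t))) <= k * t.-1.
  apply: count_iota_blocks => i ik; have ini : i + 4 * t <= n by lia.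
  by have := unbal _ ini (dom _ ini); lia.
have rest := count_size (predC c) (iota (0 + k * (4 * t)) r).
rewrite size_iota in rest.
have -> : iota 0 n = iota 0 (k * (4 * t)) ++ iota (0 + k * (4 * t)) r.
  by rewrite -iotaD -nE.
rewrite count_cat; apply: leq_ltn_trans (leq_add blocks rest) _.
by clear -t0 r_lt k_ge nE; nia.
Qed.

(** Discrete intermediate value theorem: the first window is dominated by c or
    by its negation, and [count_predC_dominated] applies to either. *)
Lemma balanced_window (c : pred nat) (n t : nat) :
    0 < t -> 8 * t <= n ->
    n./2 <= count c (iota 0 n) -> n./2 <= count (predC c) (iota 0 n) ->
  exists i, [/\ i + 4 * t <= n, t <= count c (iota i (4 * t))
    & t <= count (predC c) (iota i (4 * t))].
Proof.
move=> t0 tn halfc halfC.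
pose bal i := (t <= count c (iota i (4 * t))) &&
  (t <= count (predC c) (iota i (4 * t))).
have [/existsP[i /andP[ci Ci]]|] := boolP [exists i : 'I_(n - 4 * t).+1, bal i].
  by exists i; split => //; have := ltn_ord i; lia.
rewrite negb_exists => /forallP none.
have unbal i : i + 4 * t <= n -> ~~ bal i.
  move=> lei; have lti : i < (n - 4 * t).+1 by lia.
  exact: none (Ordinal lti).
have compl : count c (iota 0 (4 * t)) + count (predC c) (iota 0 (4 * t)) = 4 * t.
  by rewrite count_predC size_iota.
have [start|start] := leqP t (count c (iota 0 (4 * t))).
  suff : count (predC c) (iota 0 n) < n./2 by rewrite ltnNge halfC.
  apply: (@count_predC_dominated c n t) => // i lei ci.
  by have := unbal i lei; rewrite /bal ci -ltnNge.
have cCC s : count (predC (predC c)) s = count c s.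
  by apply: eq_count => x /=; rewrite negbK.
suff : count (predC (predC c)) (iota 0 n) < n./2 by rewrite cCC ltnNge halfc.
apply: (@count_predC_dominated (predC c) n t) => //; first by lia.
move=> i lei ci.
by have := unbal i lei; rewrite /bal ci andbT cCC -ltnNge.
Qed.

(** * The two graphs *)

(** The bound d <= #|G| covers the default value of the minimum. *)
Lemma leq_min_degree (G : sgraph) (d : nat) :
  d <= #|G| -> (forall v : G, d <= degree v) -> d <= min_degree G.
Proof.
move=> dG dv; rewrite /min_degree; elim/big_ind: _ => // x y dx dy.
by rewrite leq_min dx.
Qed.

(** The complement of the r-th power of a path; a set of at most r.+1
    consecutive integers is independent. *)
Definition far_adj (n r : nat) : rel 'I_n := [rel i j : 'I_n | (i + r < j) || (j + r < i)].

Lemma far_adj_sym n r : symmetric (@far_adj n r).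
Proof. by move=> i j; rewrite /far_adj /= orbC. Qed.

Lemma far_adj_irr n r : irreflexive (@far_adj n r).
Proof. by move=> i; rewrite /far_adj /= orbb ltnNge leq_addr. Qed.

Definition far_graph (n r : nat) : sgraph :=
  SGraph (@far_adj_sym n r) (@far_adj_irr n r).
Arguments far_graph : clear implicits.

Lemma min_degree_far_graph n r : n - (2 * r).+1 <= min_degree (far_graph n r).
Proof.
apply: leq_min_degree => [|i]; first by rewrite card_ord leq_subr.
rewrite /degree; set nbrs := [set _ | _].
rewrite leq_subLR -[X in X <= _](card_ord n) -(cardsC nbrs) addnC leq_add2r.
pose shift (j : 'I_n) : 'I_(2 * r).+1 := inord (j + r - i).
rewrite -(card_in_imset (f := shift)) => [|j k].
  by rewrite (leq_trans (max_card _)) ?card_ord.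
rewrite !inE /= !negb_or -!leqNgt => /andP[? ?] /andP[? ?] /(congr1 val) /=.
by rewrite !inordK => [? | | ]; [apply: val_inj => /= | |]; lia.
Qed.

Definition biadj (A B : Type) (r : A -> B -> bool) : rel (A + B) :=
  fun x y => match x, y with
             | inl a, inr b | inr b, inl a => r a b
             | _, _ => false
             end.

Lemma biadj_sym A B (r : A -> B -> bool) : symmetric (biadj r).
Proof. by case=> [?|?] [?|?]. Qed.

Lemma biadj_irr A B (r : A -> B -> bool) : irreflexive (biadj r).
Proof. by case. Qed.

Definition bigraph (A B : finType) (r : A -> B -> bool) : sgraph :=
  SGraph (biadj_sym r) (biadj_irr r).

Lemma bipartite_bigraph (A B : finType) (r : A -> B -> bool) :
  bipartite (bigraph r).
Proof.
exists [set x : A + B | if x is inl _ then true else false].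
by move=> [?|?] [?|?] //=; rewrite !inE.
Qed.

Lemma max_degree_bigraph (A B : finType) (r : A -> B -> bool) (d : nat) :
    (forall a, #|[set b | r a b]| <= d) -> (forall b, #|[set a | r a b]| <= d) ->
  max_degree (bigraph r) <= d.
Proof.
move=> degA degB; apply/bigmax_leqP => -[a|b] _; rewrite /degree.
  apply: leq_trans (degA a).
  rewrite -(card_imset _ (@inr_inj A B)); apply: subset_leq_card.
  apply/fintype.subsetP => -[?|b]; rewrite inE //= => rab.
  by apply: imset_f; rewrite inE.
apply: leq_trans (degB b).
rewrite -(card_imset _ (@inl_inj A B)); apply: subset_leq_card.
apply/fintype.subsetP => -[a|?]; rewrite inE //= => rab.
by apply: imset_f; rewrite inE.
Qed.

Lemma widen_ord_inj m n (le_mn : m <= n) : injective (widen_ord le_mn).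
Proof. by move=> i j /(congr1 val) /= /val_inj. Qed.

(** The configuration model: (a, i) is the i-th half-edge of a, and s matches
    the half-edges of the two sides.  Parallel edges are merged, so the degrees
    are at most d rather than equal to d.  One side is cut down to m vertices,
    which allows graphs of odd order. *)
Section Configuration.
Variables (m N d : nat) (le_mN : m <= N) (s : {perm 'I_N * 'I_d}).

Definition config_adj (a : 'I_m) (b : 'I_N) : bool :=
  [exists i : 'I_d, (s (widen_ord le_mN a, i)).1 == b].

Definition config_graph : sgraph := bigraph config_adj.

Lemma max_degree_config_graph : max_degree config_graph <= d.
Proof.
apply: max_degree_bigraph => [a|b].
  pose ends (i : 'I_d) := (s (widen_ord le_mN a, i)).1.
  rewrite -[leqRHS](card_ord d) (leq_trans _ (leq_imset_card ends _)) //.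
  apply: subset_leq_card; apply/fintype.subsetP => b; rewrite inE.
  by move=> /existsP[i /eqP <-]; exact: imset_f.
pose starts (j : 'I_d) := ((s^-1)%g (b, j)).1.
rewrite -[leqRHS](card_ord d) (leq_trans _ (leq_imset_card starts _)) //.
rewrite -(card_imset _ (widen_ord_inj (le_mn := le_mN))); apply: subset_leq_card.
apply/fintype.subsetP => _ /imsetP[a /[!inE] /existsP[i /eqP sai] ->].
apply/imsetP; exists (s (widen_ord le_mN a, i)).2 => //.
by rewrite /starts -sai -surjective_pairing permK.
Qed.

End Configuration.

(** Having no edge between X and Y means that s sends all the half-edges of X
    outside those of Y. *)
Lemma exists_perm_hits (N d t : nat) :
    'C(N, t) ^ 2 * (N * d - t * d) ^_ (t * d) < (N * d) ^_ (t * d) ->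
  exists s : {perm 'I_N * 'I_d}, forall X Y : {set 'I_N}, t <= #|X| -> t <= #|Y| ->
    exists2 x, x \in X & exists i, (s (x, i)).1 \in Y.
Proof.
move=> few; pose tset := {X : {set 'I_N} | #|X| == t}.
pose P (XY : tset * tset) := finset.setX (val XY.1) [set: 'I_d].
pose Q (XY : tset * tset) := ~: finset.setX (val XY.2) [set: 'I_d].
have tsetX (X : tset) : #|finset.setX (val X) [set: 'I_d]| = t * d.
  by rewrite cardsX cardsT card_ord (eqP (valP X)).
have card_tset : #|{: tset}| = 'C(N, t).
  rewrite card_sig -[N in RHS]card_ord -card_draws.
  by apply: eq_card => X; rewrite !inE.
have [||| s hits] := @first_moment_perm _ _ P Q (t * d) (N * d - t * d).
- by move=> XY; rewrite tsetX.
- by move=> XY; rewrite cardsCs finset.setCK tsetX card_prod !card_ord.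
- by rewrite !card_prod card_tset !card_ord mulnn.
have sub_t (X : {set 'I_N}) : t <= #|X| -> exists2 X' : tset, val X' \subset X & True.
  rewrite -bin_gt0 -cards_draws => /card_gt0P[X' /[!inE] /andP[X'X X't]].
  by exists (Sub X' X't).
exists s => X Y /sub_t[X' X'X _] /sub_t[Y' Y'Y _].
have /fintype.subsetPn[_ /imsetP[[x i] /[!inE] /= /andP[xX _] ->]] := hits (X', Y').
rewrite negbK andbT => sxY; exists x; first exact: fintype.subsetP xX.
by exists i; exact: fintype.subsetP sxY.
Qed.

(** * A balanced window forces a hole *)

Lemma leq_card_count_codom (T : finType) (g : T -> nat) (u : seq nat) :
    injective g -> (forall x, g x \in u) ->
  #|T| <= count [in codom g] u.
Proof.
move=> g_inj gu; rewrite -(size_codom g) -size_filter.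
apply: uniq_leq_size => [|v vg]; first exact/injectiveP.
by rewrite mem_filter vg; have /codomP[x ->] := vg; apply: gu.
Qed.

Lemma count_codom_leq (T : finType) (g : T -> nat) (u : seq nat) :
  uniq u -> count [in codom g] u <= #|[set x | g x \in u]|.
Proof.
move=> u_uniq; rewrite -size_filter -(size_image g).
apply: uniq_leq_size => [|v]; first exact: filter_uniq.
rewrite mem_filter => /andP[/codomP[x ->] gxu].
by apply: fintype.image_f; rewrite inE.
Qed.

Lemma half_leq_uphalf n : n./2 <= uphalf n.
Proof. by rewrite uphalf_half leq_addl. Qed.

(** An embedding would make the images of the two sides complementary in
    [0, n), and a balanced window for this partition would contain an edge of H
    although it is independent in the far graph. *)
Lemma not_contains_far_config (n d t : nat) (s : {perm 'I_(uphalf n) * 'I_d}) :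
    0 < t -> 8 * t <= n ->
    (forall X Y : {set 'I_(uphalf n)}, t <= #|X| -> t <= #|Y| ->
       exists2 x, x \in X & exists i, (s (x, i)).1 \in Y) ->
  ~ contains (far_graph n (4 * t).-1) (config_graph (half_leq_uphalf n) s).
Proof.
move=> t0 tn hits [f [f_inj f_adj]].
have f_onto (v : 'I_n) : v \in codom f.
  apply: inj_card_onto => //.
  by rewrite card_sum !card_ord uphalf_half; have := odd_double_half n; lia.
pose gA (a : 'I_(n./2)) : nat := val (f (inl a)).
pose gB (b : 'I_(uphalf n)) : nat := val (f (inr b)).
have gA_inj : injective gA by move=> x y /val_inj /f_inj [].
have gB_inj : injective gB by move=> x y /val_inj /f_inj [].
pose c : pred nat := [in codom gA].
have gB_c v : v \in codom gB -> predC c v.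
  move=> /codomP[b ->]; apply/negP => /codomP[a].
  by move=> /val_inj /f_inj.
have c_gB v : v < n -> predC c v -> v \in codom gB.
  move=> vn; have /codomP[[a|b] fv] := f_onto (Ordinal vn).
    by case/negP; apply/codomP; exists a; rewrite /gA -fv.
  by move=> _; apply/codomP; exists b; rewrite /gB -fv.
have [| | i [ile cA cB]] := @balanced_window c n t t0 tn.
- rewrite -[X in X <= _](card_ord n./2); apply: leq_card_count_codom => // a.
  by rewrite mem_iota /gA /=.
- apply: leq_trans (half_leq_uphalf n) _.
  rewrite -[X in X <= _](card_ord (uphalf n)).
  apply: leq_trans (leq_card_count_codom (u := iota 0 n) gB_inj _) _ => [b|].
    by rewrite mem_iota /gB /=.
  exact: sub_count.
pose win := iota i (4 * t).
have tX : t <= #|[set widen_ord (half_leq_uphalf n) a | a in [set a | gA a \in win]]|.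
  rewrite card_imset; last exact: widen_ord_inj.
  by apply: leq_trans cA (count_codom_leq _ _); apply: iota_uniq.
have tY : t <= #|[set b | gB b \in win]|.
  apply: leq_trans cB _; apply: leq_trans (count_codom_leq gB (iota_uniq _ _)).
  rewrite -!size_filter; apply: uniq_leq_size; first exact/filter_uniq/iota_uniq.
  move=> v; rewrite !mem_filter mem_iota => /andP[cv /andP[iv vi]].
  by rewrite iv vi c_gB //; lia.
have [_ /imsetP[a /[!inE] aW ->] [j /[!inE] bW]] := hits _ _ tX tY.
set b := (s _).1 in bW.
have : far_adj (4 * t).-1 (f (inl a)) (f (inr b)).
  by apply: f_adj => /=; apply/existsP; exists j.
by move: aW bW; rewrite /far_adj /win !mem_iota /gA /gB /=; lia.
Qed.

(** * First moment estimate *)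

Local Open Scope ring_scope.

(** The left-hand side is one term of the expansion of (1 + x) ^+ N. *)
Lemma bin_exprn_le_expR (R : realType) (N t : nat) (x : R) :
  0 <= x -> 'C(N, t)%:R * x ^+ t <= expR (N%:R * x).
Proof.
move=> x0; rewrite expRM_natl.
apply: le_trans (_ : (1 + x) ^+ N <= _); last first.
  by apply: lerXn2r; rewrite ?nnegrE ?expR_ge0 ?addr_ge0 ?expR_ge1Dx.
have [tN|Nt] := leqP t N; last by rewrite bin_small // mul0r exprn_ge0 ?addr_ge0.
have tN1 : (t < N.+1)%N by [].
rewrite exprDn (bigD1 (Ordinal tN1)) //= expr1n mul1r mulr_natl lerDl.
by apply: sumr_ge0 => i _; rewrite expr1n mul1r mulrn_wge0 ?exprn_ge0.
Qed.

(** With x = t / N and l = ln d, the number of t-subsets is at most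
    (e / x)^t <= exp(2 t l), and q / m = 1 - x makes the probability of a hole at
    most exp(- x t d) <= exp(- 5 t l).  The union bound over pairs of t-subsets
    leaves exp(4 t l - 5 t l) < 1. *)
Lemma first_moment_lt (R : realType) (N d t : nat) :
    (0 < t <= N)%N -> 1 <= ln (d%:R : R) ->
    5 * N%:R * ln (d%:R : R) <= t%:R * d%:R ->
  ('C(N, t) ^ 2 * (N * d - t * d) ^_ (t * d) < (N * d) ^_ (t * d))%N.
Proof.
move=> /andP[t0 tN] ln1 tlarge; set l := ln _ in ln1 tlarge.
have d0 : (0 < d)%N.
  by rewrite lt0n; apply: contraL ln1 => /eqP d0; rewrite -ltNge /l d0 ln0 ?ltr01.
have dR : 0 < d%:R :> R by rewrite ltr0n.
have N0 : (0 < N)%N := leq_trans t0 tN.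
have NR : 0 < N%:R :> R by rewrite ltr0n.
have tR : 0 < t%:R :> R by rewrite ltr0n.
have dE : d%:R = expR l by rewrite lnK ?posrE.
pose x : R := t%:R / N%:R.
have x0 : 0 < x by rewrite divr_gt0.
have x1 : x <= 1 by rewrite ler_pdivrMr // mul1r ler_nat.
have xd : 5 * l <= x * d%:R by rewrite /x mulrAC ler_pdivlMr //; lra.
have bin_le : 'C(N, t)%:R <= expR (t%:R * (2 * l)).
  have : 'C(N, t)%:R * x ^+ t <= expR t%:R.
    rewrite (le_trans (bin_exprn_le_expR _ _ (ltW x0))) //.
    by rewrite mulrCA divff ?mulr1 ?gt_eqF.
  rewrite -ler_pdivlMr ?exprn_gt0 // => /le_trans; apply.
  have : (x ^+ t)^-1 <= d%:R ^+ t.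
    rewrite -exprVn; apply: lerXn2r; rewrite ?nnegrE ?invr_ge0 ?(ltW x0) ?(ltW dR) //.
    by rewrite -[leLHS]mul1r ler_pdivrMr //; lra.
  rewrite dE -expRM_natl => le_inv.
  apply: le_trans (ler_wpM2l (expR_ge0 _) le_inv) _.
  by rewrite -expRD ler_expR; nra.
have pow_le : (1 - x) ^+ (t * d) <= expR (- (t%:R * (5 * l))).
  apply: le_trans (_ : expR (- x) ^+ (t * d) <= _).
    by apply: lerXn2r; rewrite ?nnegrE ?expR_ge0 ?subr_ge0 ?expR_ge1Dx.
  by rewrite -expRM_natl ler_expR natrM; nra.
have moment : 'C(N, t)%:R ^+ 2 * (1 - x) ^+ (t * d) < 1.
  apply: le_lt_trans (_ : expR (t%:R * (2 * l)) ^+ 2 * expR (- (t%:R * (5 * l))) < 1).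
    apply: ler_pM => //; rewrite ?exprn_ge0 ?ler0n ?subr_ge0 //.
    by rewrite lerXn2r ?nnegrE ?expR_ge0 ?ler0n.
  by rewrite -expRM_natl -expRD expR_lt1; nra.
have powers : ('C(N, t) ^ 2 * (N * d - t * d) ^ (t * d) < (N * d) ^ (t * d))%N.
  rewrite -(ltr_nat R) natrM [X in X * _ < _]natrX -mulnBl !natrX !natrM natrB //.
  have -> : (N%:R - t%:R) * d%:R = N%:R * d%:R * (1 - x) :> R.
    by rewrite /x; field; rewrite gt_eqF.
  rewrite exprMn mulrCA -[ltRHS]mulr1 ltr_pM2l //.
  by rewrite exprn_gt0 ?mulr_gt0.
have falling_gt0 : (0 < (N * d) ^_ (t * d))%N by rewrite ffact_gt0 leq_mul2r tN orbT.
rewrite -(ltn_pmul2r (m := (N * d) ^ (t * d))) ?expn_gt0 ?muln_gt0 ?N0 ?d0 //.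
rewrite [ltnRHS]mulnC; apply: leq_ltn_trans (_ : _ <= 'C(N, t) ^ 2 *
  ((N * d - t * d) ^ (t * d) * (N * d) ^_ (t * d)))%N _.
  by rewrite -mulnA leq_mul2l ffact_ratio ?orbT ?leq_subr.
by rewrite mulnA ltn_pmul2r.
Qed.

(** * The theorem *)

Unset Implicit Arguments.

Theorem theorem2 (R : realType) (Delta n : nat)
    (hDelta : (2 <= Delta)%N) (hn : (Delta + 1 <= n)%N) :
  exists H G : sgraph,
    [/\ #|H| = n, bipartite H & (max_degree H <= Delta)%N] /\
    [/\ #|G| = n,
        (1 - 164 * (ln (Delta%:R : R) / Delta%:R)) * n%:R
          <= ((min_degree G)%:R : R)
      & ~ contains G H].
Proof.
have config_ok (s : {perm 'I_(uphalf n) * 'I_Delta}) :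
    let H := config_graph (half_leq_uphalf n) s in
    [/\ #|H| = n, bipartite H & (max_degree H <= Delta)%N].
  split; [|exact: bipartite_bigraph|exact: max_degree_config_graph].
  by rewrite card_sum !card_ord uphalf_half; have := odd_double_half n; lia.
set u : R := ln _ / _.
have DR : 0 < Delta%:R :> R by rewrite ltr0n; lia.
have [u_small|u_large] := ltP (164 * u) 1; last first.
  exists (config_graph (half_leq_uphalf n) (1%g : {perm 'I_(uphalf n) * 'I_Delta})).
  exists (far_graph n n); split; [exact: config_ok | split].
  - by rewrite card_ord.
  - by rewrite (le_trans _ (ler0n _ _)) // mulr_le0_ge0 ?subr_le0.
  have n2 : (0 < n./2)%N by have := odd_double_half n; lia.
  have D0 : (0 < Delta)%N by lia.
  pose a : 'I_(n./2) := Ordinal n2; pose b := widen_ord (half_leq_uphalf n) a.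
  case=> f [_ f_adj].
  suff /negP[] : ~~ far_adj n (f (inl a)) (f (inr b)).
    by apply: f_adj; apply/existsP; exists (Ordinal D0); rewrite perm1.
  have far0 (i j : 'I_n) : ~~ far_adj n i j.
    by rewrite /far_adj /=; have := ltn_ord i; have := ltn_ord j; lia.
  exact: far0.
have lnD : ln (Delta%:R : R) = u * Delta%:R by rewrite divfK ?gt_eqF.
(* A large D makes ln D >= 1: first ln 2 >= 1/2 excludes D < 4, and then
   ln D >= 2 ln 2. *)
have ln2 : 1 / 2 <= ln (2 : R).
  have := @le_ln1Dx R (- (1 / 2)); rewrite ltrN2 => /(_ _).
  have -> : 1 + - (1 / 2) = 2^-1 :> R by lra.
  rewrite lnV ?posrE; lra.
have ln_mono (k : nat) : (2 ^ k <= Delta)%N -> k%:R / 2 <= ln (Delta%:R : R).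
  rewrite -(ler_nat R) natrX => kD.
  apply: le_trans (_ : ln (2 ^+ k) <= _); last by rewrite ler_ln ?posrE ?exprn_gt0.
  by rewrite lnXn // -mulr_natl; have := ler0n R k; nra.
have lnD1 : 1 <= ln (Delta%:R : R).
  have := ln_mono 1%N hDelta; rewrite lnD => uD.
  have D4 : (2 ^ 2 <= Delta)%N by rewrite -(ler_nat R); nra.
  by have := ln_mono 2%N D4; rewrite lnD; lra.
have u0 : 0 < u by rewrite divr_gt0 // (lt_le_trans ltr01).
have nR : Delta%:R + 1 <= n%:R :> R by rewrite -[1]/(1%:R) -natrD ler_nat.
(* With the constant 20, 8 t <= 160 u n < n, and rounding down costs little
   because u n >= 1. *)
pose t := Num.truncn (20 * u * n%:R).
have un : 1 <= u * n%:R by move: lnD1; rewrite lnD; nra.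
have /andP[t_le t_gt] : t%:R <= 20 * u * n%:R < t.+1%:R by apply: truncn_itv; lra.
rewrite -natr1 in t_gt.
have t0 : (0 < t)%N by rewrite -(ltr_nat R); lra.
have tn : (8 * t <= n)%N by rewrite -(ler_nat R) natrM; nra.
have [|s hits] := @exists_perm_hits (uphalf n) Delta t.
  apply: (@first_moment_lt R) => //; first by rewrite t0 uphalf_half; lia.
  have : (uphalf n)%:R <= n%:R :> R by rewrite ler_nat uphalf_half; lia.
  rewrite lnD; nra.
exists (config_graph (half_leq_uphalf n) s), (far_graph n (4 * t).-1).
split; [exact: config_ok | split].
- by rewrite card_ord.
- apply: le_trans (_ : (n - 8 * t)%:R <= _); last first.
    rewrite ler_nat; apply: leq_trans (min_degree_far_graph _ _); lia.
  by rewrite natrB // natrM; nra.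
- exact: not_contains_far_config.
Qed.
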